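(* Let $P_0=\begin{pmatrix} q & s\\ s & r\end{pmatrix}\in\mathbb{S}^2$ with $r\le 0$ and let $$\mathbf{V}=\left\{vI_k \;\middle|\; v\in\mathbb{C},\ \begin{pmatrix}1\\ v\end{pmatrix}^{*}P_0\begin{pmatrix}1\\ v\end{pmatrix}\ge 0\ \text{ and }\ \begin{pmatrix}1\\ v\end{pmatrix}^{*}\begin{pmatrix}0&i\\ -i&0\end{pmatrix}\begin{pmatrix}1\\ v\end{pmatrix}=0\right\}.$$ Let $\begin{pmatrix}A_\psi&B_\psi\\ C_\psi&D_\psi\end{pmatrix}\in\mathbb{R}^{(n_\psi+m_\psi)\times(n_\psi+k)}$ with $A_\psi\in\mathbb{R}^{n_\psi\times n_\psi}$ stable (Hurwitz) be given and abbreviate $J_\Psi:=\mathrm{diag}(J_\psi,J_\psi)$ for $J\in\{A,B,C,D\}$. Then the uncertain interconnection $$\begin{pmatrix}\dot x(t)\\ z(t)\end{pmatrix}=\begin{pmatrix}A&B\\ C&D\end{pmatrix}\begin{pmatrix}x(t)\\ w(t)\end{pmatrix},\quad w(t)=\Delta(z)(t),\quad t\ge0,\quad \Delta\in\mathbf{\Delta}(\mathbf{V}),$$ is robustly stable if there exist $X\in\mathbb{S}^{2n_\psi+n}$, $Y\in\mathbb{S}^{n_\psi}$, $Z\in\mathbb{S}^{n_\psi}$, $M\in\mathbb{S}^{m_\psi}$ and $N\in\mathbb{R}^{m_\psi\times m_\psi}$ satisfying $$\begin{pmatrix} I&0\\ A_\psi&B_\psi\end{pmatrix}^T\begin{pmatrix}0&Y\\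 Y&0\end{pmatrix}\begin{pmatrix} I&0\\ A_\psi&B_\psi\end{pmatrix}+\begin{pmatrix}C_\psi&D_\psi\end{pmatrix}^TM\begin{pmatrix}C_\psi&D_\psi\end{pmatrix}\succ0,$$ $$\begin{pmatrix} I&0\\ A_\psi&B_\psi\end{pmatrix}^T\begin{pmatrix}0&Z\\ Z&0\end{pmatrix}\begin{pmatrix} I&0\\ A_\psi&B_\psi\end{pmatrix}+\begin{pmatrix}C_\psi&D_\psi\end{pmatrix}^T(N^T+N)\begin{pmatrix}C_\psi&D_\psi\end{pmatrix}=0,$$ $$H^T\begin{pmatrix}0&X&0\\ X&0&0\\ 0&0&P_0\otimes M+\begin{pmatrix}0&N\\ N^T&0\end{pmatrix}\end{pmatrix}H\prec0\quad\text{with}\quad H=\begin{pmatrix}I&0&0\\ 0&I&0\\ A_\Psi&B_\Psi\begin{pmatrix}C\\ 0\end{pmatrix}&B_\Psi\begin{pmatrix}D\\ I_k\end{pmatrix}\\ 0&A&B\\ C_\Psi&D_\Psi\begin{pmatrix}C\\ 0\end{pmatrix}&D_\Psi\begin{pmatrix}D\\ I_k\end{pmatrix}\end{pmatrix},$$ and $$X-\begin{pmatrix}P_0\otimes Y+\frac12\begin{pmatrix}0&Z\\ Z&0\end{pmatrix}&0\\ 0&0\end{pmatrix}\succ0.$$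
   Context: $\mathbb{S}^n$ is the set of real symmetric $n\times n$ matrices; $\otimes$ is the Kronecker product; ${}^*$ is the conjugate transpose; $L_{2e}^n$ is the space of locally square integrable functions $[0,\infty)\to\mathbb{R}^n$; $\mathrm{RH}_\infty^{m\times n}$ is the space of real rational $m\times n$ matrices without poles in the extended closed right half-plane. $A\in\mathbb{R}^{n\times n}$, $B\in\mathbb{R}^{n\times l}$, $C\in\mathbb{R}^{k\times n}$, $D\in\mathbb{R}^{k\times l}$ are given real matrices (here $l=k$). Uncertainties: $\Delta$ is a stable LTI system with input-output map $\Delta:L_{2e}^k\to L_{2e}^l$, $$\Delta(z)(t)=\int_0^tC_\Delta e^{A_\Delta(t-s)}B_\Delta z(s)\,ds+D_\Delta z(t),$$ for some real matrices $A_\Delta,B_\Delta,C_\Delta,D_\Delta$. The same symbol denotes its transfer matrix $\Delta(s)=C_\Delta(sI-A_\Delta)^{-1}B_\Delta+D_\Delta$; stability means $\Delta\in\mathrm{RH}_\infty^{l\times k}$. For $\mathbf{V}\subset\mathbb{C}^{l\times k}$, $\mathbf{\Delta}(\mathbf{V})$ is the set of all such $\Delta$ with $\Delta(i\omega)\in\mathbf{V}$ for all $\omega\in\mathbb{R}\cup\{\infty\}$. Robust stability: the interconnection is robustly stable if it is well-posed, i.e., $\det(I-DV)\ne0$ for all $V\in\mathbf{V}$, and if there exists a constant $M_0>0$ such that the state-trajectories satisfy $\lim_{t\to\infty}x(t)=0$ and $\|x(t)\|\le M_0\|x(0)\|$ for all $t\ge0$, for all initial conditions $x(0)\in\mathbb{R}^n$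 and any $\Delta\in\mathbf{\Delta}(\mathbf{V})$. *)

(* Defs.v *)
From HB Require Import structures.
From mathcomp Require Import all_boot all_order all_algebra.
From mathcomp Require Import complex mxtens.
From mathcomp Require Import all_classical all_reals all_analysis.
Import Order.TTheory GRing.Theory Num.Theory.
Import numFieldNormedType.Exports.

Set Implicit Arguments.
Unset Strict Implicit.
Unset Printing Implicit Defensive.

Local Open Scope classical_set_scope.
Local Open Scope ring_scope.

Definition posdefmx (R : realType) n (S : 'M[R]_n) : Prop :=
  S^T = S /\ forall u : 'cV[R]_n, u != 0 -> 0 < (u^T *m S *m u) 0 0.

Definition negdefmx (R : realType) n (S : 'M[R]_n) : Prop := posdefmx (- S).

Definition cplxmx (R : realType) m n (S : 'M[R]_(m, n)) : 'M[R[i]]_(m, n) :=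
  map_mx (real_complex R) S.

Definition ctrmx (R : realType) m n (S : 'M[R[i]]_(m, n)) : 'M[R[i]]_(n, m) :=
  map_mx Num.conj S^T.

Definition hurwitz (R : realType) n (S : 'M[R]_n) : Prop :=
  forall lam : R[i], eigenvalue (cplxmx S) lam -> complex.Re lam < 0.

Definition vnorm (R : realType) n (u : 'cV[R]_n) : R :=
  Num.sqrt (\sum_(i < n) u i 0 ^+ 2).

Definition mxexp (R : realType) n (S : 'M[R]_n) : 'M[R]_n :=
  \matrix_(i < n, j < n)
    limn (series (fun m : nat => (m`!%:R)^-1 * (S ^+ m) i j)).

Definition vint (R : realType) n (a b : R) (f : R -> 'cV[R]_n) : 'cV[R]_n :=
  \col_(i < n) \int[lebesgue_measure]_(s in `[a, b]) f s i 0.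

(* Functions on [0, oo) are represented by functions on the whole line whose
   values at negative times are irrelevant. *)
Definition L2e (R : realType) n (f : R -> 'cV[R]_n) : Prop :=
  (forall i, measurable_fun (`[0, +oo[ : set R) (fun t : R => f t i 0)) /\
  (forall T : R,
     (\int[lebesgue_measure]_(t in `[0%R, T]) (vnorm (f t) ^+ 2)%:E < +oo)%E).

Definition ratfun (R : realType) := {fraction {poly R}}.

(* The representative of a fraction need not be in lowest terms. *)
Definition rf_num (R : realType) (f : ratfun R) : {poly R} :=
  let: (p, q) := frac (repr f) in p %/ gcdp p q.
Definition rf_den (R : realType) (f : ratfun R) : {poly R} :=
  let: (p, q) := frac (repr f) in q %/ gcdp p q.

Definition rf_pole (R : realType) (f : ratfun R) (s : R[i]) : Prop :=
  root (map_poly (real_complex R) (rf_den f)) s.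
Definition rf_pole_infty (R : realType) (f : ratfun R) : Prop :=
  (size (rf_den f) < size (rf_num f))%N.

Definition rf_eval (R : realType) (f : ratfun R) (s : R[i]) : R[i] :=
  (map_poly (real_complex R) (rf_num f)).[s] /
  (map_poly (real_complex R) (rf_den f)).[s].

(* The limit of f at infinity when f is proper. *)
Definition rf_eval_infty (R : realType) (f : ratfun R) : R[i] :=
  real_complex R ((rf_num f)`_(size (rf_den f)).-1 / lead_coef (rf_den f)).

Definition RHinf (R : realType) m n (G : 'M[ratfun R]_(m, n)) : Prop :=
  forall i j, ~ rf_pole_infty (G i j) /\
    forall s : R[i], 0 <= complex.Re s -> ~ rf_pole (G i j) s.

Record lti (R : realType) (l k : nat) := Lti {
  lti_dim : nat;
  lti_A : 'M[R]_lti_dim;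
  lti_B : 'M[R]_(lti_dim, k);
  lti_C : 'M[R]_(l, lti_dim);
  lti_D : 'M[R]_(l, k) }.

Definition lti_map (R : realType) l k (G : lti R l k)
    (z : R -> 'cV[R]_k) (t : R) : 'cV[R]_l :=
  vint 0 t (fun s => lti_C G *m mxexp ((t - s) *: lti_A G) *m lti_B G *m z s)
  + lti_D G *m z t.

Definition ratmx (R : realType) m n (S : 'M[R]_(m, n)) : 'M[ratfun R]_(m, n) :=
  map_mx (fun c : R => tofrac c%:P) S.

Definition transfer (R : realType) l k (G : lti R l k) : 'M[ratfun R]_(l, k) :=
  ratmx (lti_C G)
    *m invmx ((tofrac 'X : ratfun R)%:M - ratmx (lti_A G))
    *m ratmx (lti_B G)
  + ratmx (lti_D G).

Definition uncertainty (R : realType) l k (V : set 'M[R[i]]_(l, k))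
    : set (lti R l k) :=
  [set G | [/\ RHinf (transfer G),
     forall omega : R,
       V (map_mx (fun f => rf_eval f (Complex 0 omega)) (transfer G)) &
     V (map_mx (@rf_eval_infty R) (transfer G))]].

(* Carathéodory solutions with locally square integrable signals; signals are
   identified up to null sets. *)
Definition trajectory (R : realType) n l k
    (A : 'M[R]_n) (B : 'M[R]_(n, l)) (C : 'M[R]_(k, n)) (D : 'M[R]_(k, l))
    (G : lti R l k)
    (x : R -> 'cV[R]_n) (z : R -> 'cV[R]_k) (w : R -> 'cV[R]_l) : Prop :=
  [/\ L2e z /\ L2e w,
      {within `[0, +oo[, continuous x},
      forall t : R, 0 <= t ->
        x t = x 0 + vint 0 t (fun s => A *m x s + B *m w s),
      {ae (@lebesgue_measure R), forall t : R, 0 <= t ->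
        z t = C *m x t + D *m w t} &
      {ae (@lebesgue_measure R), forall t : R, 0 <= t -> w t = lti_map G z t}].

Definition robustly_stable (R : realType) n l k
    (A : 'M[R]_n) (B : 'M[R]_(n, l)) (C : 'M[R]_(k, n)) (D : 'M[R]_(k, l))
    (V : set 'M[R[i]]_(l, k)) : Prop :=
  (forall v, V v -> \det (1%:M - cplxmx D *m v) != 0) /\
  exists2 M0 : R, 0 < M0 &
    forall G : lti R l k, uncertainty V G ->
    forall x z w, trajectory A B C D G x z w ->
      x t @[t --> +oo] --> (0 : 'cV[R]_n) /\
      forall t : R, 0 <= t -> vnorm (x t) <= M0 * vnorm (x 0).

Definition mx2 (T : nzRingType) (a b c d : T) : 'M[T]_(1 + 1) :=
  block_mx a%:M b%:M c%:M d%:M.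

Definition stack1 (T : nzRingType) (v : T) : 'cV[T]_(1 + 1) :=
  col_mx 1%:M v%:M.

Definition real_repeated (R : realType) (k : nat) (P0 : 'M[R]_(1 + 1))
    : set 'M[R[i]]_k :=
  [set U | exists v : R[i],
     [/\ U = v%:M,
         0 <= (ctrmx (stack1 v) *m cplxmx P0 *m stack1 v) 0 0 &
         (ctrmx (stack1 v) *m mx2 0 'i (- 'i) 0 *m stack1 v) 0 0 = 0]].

Lemma dim2E m : ((1 + 1) * m = m + m)%N.
Proof. by rewrite mul2n addnn. Qed.

Definition kron2 (R : realType) m (P : 'M[R]_(1 + 1)) (S : 'M[R]_m)
    : 'M[R]_(m + m) :=
  castmx (dim2E m, dim2E m) (tensmx P S).

Definition diag2 (R : realType) m n (J : 'M[R]_(m, n)) : 'M[R]_(m + m, n + n) :=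
  block_mx J 0 0 J.

Definition outer_factor (R : realType) n k np mp
    (A : 'M[R]_n) (B : 'M[R]_(n, k)) (C : 'M[R]_(k, n)) (D : 'M[R]_k)
    (Ap : 'M[R]_np) (Bp : 'M[R]_(np, k)) (Cp : 'M[R]_(mp, np))
    (Dp : 'M[R]_(mp, k))
    : 'M[R]_(((np + np) + n) + ((np + np) + n) + (mp + mp), (np + np) + n + k) :=
  let C0 : 'M[R]_(k + k, n) := col_mx C 0 in
  let DI : 'M[R]_(k + k, k) := col_mx D 1%:M in
  col_mx
    (col_mx
      (col_mx (row_mx (row_mx 1%:M 0) 0)
              (row_mx (row_mx 0 1%:M) 0))
      (col_mx (row_mx (row_mx (diag2 Ap) (diag2 Bp *m C0)) (diag2 Bp *m DI))
              (row_mx (row_mx 0 A) B)))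
    (row_mx (row_mx (diag2 Cp) (diag2 Dp *m C0)) (diag2 Dp *m DI)).

(* Main.v *)
Require Import Defs.
From HB Require Import structures.
From mathcomp Require Import all_boot all_order all_algebra.
From mathcomp Require Import complex mxtens.
From mathcomp Require Import all_classical all_reals all_analysis.
From mathcomp Require Import measurable_realfun.
From mathcomp Require Import ring lra.
Import Order.TTheory GRing.Theory Num.Theory.
Import numFieldNormedType.Exports.

Set Implicit Arguments.
Unset Strict Implicit.
Unset Printing Implicit Defensive.

Local Open Scope classical_set_scope.
Local Open Scope ring_scope.

(** The frequency-domain description of the uncertainties is far more rigid than
    it looks.  Each entry [f] of the transfer matrix is real on the imaginary axis,
    where complex conjugation is [s -> - s]; hence [f(s) = f(- s)] identically, the
    poles of [f] are symmetric about the imaginary axis, and a stable [f] has no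
    poles at all.  Being proper, it is constant ([real_on_axis_const]).  So every
    admissible transfer matrix is [c I] with a single real [c] that satisfies
    [q + 2 s c + r c^2 >= 0] ([uncertainty_gain]).  Comparing degrees in the resolvent
    shows that all Markov parameters of a realisation of a constant vanish
    ([transfer_const]), so that the input-output map is the gain [z -> c z]
    ([lti_map_const]), whatever unobservable or uncontrollable modes the
    realisation has.

    It remains to stabilise [x' = A x + B w], [z = C x + D w], [w = c z] uniformly in
    [c].  Run the filter on [z], with state [xi] and output [y]; run on [w = c z] from
    [c xi] it has state [c xi] and output [c y].  Along such signals the supply
    rate in the main matrix inequality is
    [(q + 2 s c + r c^2) y^T M y + c y^T (N + N^T) y], and the two conditions on
    the filter say that it is dissipative for the supply rates [y^T M y] and
    [y^T (N + N^T) y] with the storage functions [- xi^T Y xi] and [- xi^T Z xi], in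
    the second case without loss, so that the sign of [c] does not matter.
    Absorbing the storage functions into [X] yields exactly the matrix
    [T = X - diag(P0 (x) Y + (0 Z; Z 0) / 2, 0)] that is assumed positive definite,
    and the form [T] decreases along the interconnection ([dissipation]).  Applied
    to the zero state, this also gives well-posedness ([well_posed]).

    The restriction of [T] to the states [(xi, c xi, x)] is thus a Lyapunov function
    for the interconnection together with its filter.  Instead of solving the
    filter equation, [xi] is eliminated by minimisation: the Schur complement is a
    Lyapunov function for [x] alone ([schur_lyapunov]).  It lies between the
    multiple of [|x|^2] below [T] given by coercivity and the value of [T] at
    [(0, 0, x)], neither of which depends on [c] ([uniform_lyapunov]).  Their ratio
    gives the bound on [|x(t)| / |x(0)|] for all uncertainties at once, and strict
    decrease gives convergence to zero ([lyapunov_stable]). *)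

(** * Quadratic forms *)

Section QuadraticForms.
Variable R : realType.

Definition bform m n (S : 'M[R]_(m, n)) (a : 'cV[R]_m) (b : 'cV[R]_n) : R :=
  (a^T *m S *m b) 0 0.

Lemma bformDl m n (S : 'M[R]_(m, n)) a1 a2 b :
  bform S (a1 + a2) b = bform S a1 b + bform S a2 b.
Proof. by rewrite /bform linearD /= !mulmxDl mxE. Qed.

Lemma bformDr m n (S : 'M[R]_(m, n)) a b1 b2 :
  bform S a (b1 + b2) = bform S a b1 + bform S a b2.
Proof. by rewrite /bform mulmxDr mxE. Qed.

Lemma bformZl m n (S : 'M[R]_(m, n)) c a b : bform S (c *: a) b = c * bform S a b.
Proof. by rewrite /bform linearZ /= -!scalemxAl mxE. Qed.

Lemma bformZr m n (S : 'M[R]_(m, n)) c a b : bform S a (c *: b) = c * bform S a b.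
Proof. by rewrite /bform -!scalemxAr mxE. Qed.

Lemma bformNr m n (S : 'M[R]_(m, n)) a b : bform S a (- b) = - bform S a b.
Proof. by rewrite -scaleN1r bformZr mulN1r. Qed.

Lemma bform0l m n (S : 'M[R]_(m, n)) b : bform S 0 b = 0.
Proof. by rewrite /bform trmx0 !mul0mx mxE. Qed.

Lemma bform0r m n (S : 'M[R]_(m, n)) a : bform S a 0 = 0.
Proof. by rewrite /bform mulmx0 mxE. Qed.

Lemma bform_zero m n (a : 'cV[R]_m) (b : 'cV[R]_n) : bform 0 a b = 0.
Proof. by rewrite /bform mulmx0 mul0mx mxE. Qed.

Lemma bform_addmx m n (S1 S2 : 'M[R]_(m, n)) a b :
  bform (S1 + S2) a b = bform S1 a b + bform S2 a b.
Proof. by rewrite /bform mulmxDr mulmxDl mxE. Qed.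

Lemma bform_oppmx m n (S : 'M[R]_(m, n)) a b : bform (- S) a b = - bform S a b.
Proof. by rewrite /bform mulmxN mulNmx mxE. Qed.

Lemma bform_scalemx m n c (S : 'M[R]_(m, n)) a b :
  bform (c *: S) a b = c * bform S a b.
Proof. by rewrite /bform -scalemxAr -scalemxAl mxE. Qed.

Lemma bform_tr m n (S : 'M[R]_(m, n)) a b : bform S a b = bform S^T b a.
Proof.
by rewrite /bform -[in LHS](trmxK (a^T *m S *m b)) mxE !trmx_mul trmxK mulmxA.
Qed.

Lemma bform_congr m n m' n' (E : 'M[R]_(m, m')) (S : 'M[R]_(m, n))
    (F : 'M[R]_(n, n')) a b :
  bform (E^T *m S *m F) a b = bform S (E *m a) (F *m b).
Proof. by rewrite /bform trmx_mul !mulmxA. Qed.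

Lemma bform_mulr m n p (S : 'M[R]_(m, n)) (F : 'M[R]_(n, p)) a b :
  bform (S *m F) a b = bform S a (F *m b).
Proof. by rewrite /bform !mulmxA. Qed.

Lemma bform_block m1 m2 n1 n2 (S11 : 'M[R]_(m1, n1)) S12 S21
    (S22 : 'M[R]_(m2, n2)) a1 a2 b1 b2 :
  bform (block_mx S11 S12 S21 S22) (col_mx a1 a2) (col_mx b1 b2) =
  bform S11 a1 b1 + bform S21 a2 b1 + (bform S12 a1 b2 + bform S22 a2 b2).
Proof.
by rewrite /bform tr_col_mx mul_row_block mul_row_col !mulmxDl !mxE.
Qed.

Lemma bformE m n (P : 'M[R]_(m, n)) u v : bform P u v = \sum_i u i 0 * (P *m v) i 0.
Proof.
by rewrite /bform -mulmxA mxE; apply: eq_bigr => i _; rewrite mxE.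
Qed.

Definition sqnorm n (u : 'cV[R]_n) : R := \sum_(i < n) u i 0 ^+ 2.

Lemma bform1 n (u : 'cV[R]_n) : bform 1%:M u u = sqnorm u.
Proof.
rewrite /bform mulmx1 mxE; apply: eq_bigr => i _.
by rewrite mxE expr2.
Qed.

Lemma sqnorm_ge0 n (u : 'cV[R]_n) : 0 <= sqnorm u.
Proof. by apply: sumr_ge0 => i _; apply: sqr_ge0. Qed.

Lemma sqr_coord_le n (u : 'cV[R]_n) i : u i 0 ^+ 2 <= sqnorm u.
Proof.
rewrite /sqnorm (bigD1 i) //= lerDl.
by apply: sumr_ge0 => j _; apply: sqr_ge0.
Qed.

Lemma sqnorm_eq0 n (u : 'cV[R]_n) : (sqnorm u == 0) = (u == 0).
Proof.
apply/idP/idP => [/eqP u0|/eqP ->]; last first.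
  by rewrite /sqnorm big1 // => i _; rewrite mxE expr0n.
apply/eqP/matrixP => i j; rewrite !mxE ord1.
by apply/eqP; rewrite -sqrf_eq0 eq_le sqr_ge0 andbT -u0 sqr_coord_le.
Qed.

Lemma sqnorm0 n : sqnorm (0 : 'cV[R]_n) = 0.
Proof. by apply/eqP; rewrite sqnorm_eq0. Qed.

Lemma sqnorm_col_mx m n (a : 'cV[R]_m) (b : 'cV[R]_n) :
  sqnorm (col_mx a b) = sqnorm a + sqnorm b.
Proof.
rewrite /sqnorm big_split_ord /=; congr (_ + _); apply: eq_bigr => i _.
  by rewrite col_mxEu.
by rewrite col_mxEd.
Qed.

Definition mxabs_sum m n (S : 'M[R]_(m, n)) : R := \sum_i \sum_j `|S i j|.

Lemma mxabs_sum_ge0 m n (S : 'M[R]_(m, n)) : 0 <= mxabs_sum S.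
Proof. by apply: sumr_ge0 => i _; apply: sumr_ge0. Qed.

Lemma bform_le_abs_sum n (S : 'M[R]_n) u :
  bform S u u <= mxabs_sum S * sqnorm u.
Proof.
rewrite /bform /mxabs_sum mxE exchange_big /= mulr_suml ler_sum // => j _.
rewrite mxE !mulr_suml ler_sum // => i _; rewrite mxE.
have abs_le l : `|u l 0| ^+ 2 <= sqnorm u by rewrite real_normK ?num_real ?sqr_coord_le.
have uu : `|u i 0 * u j 0| <= sqnorm u.
  rewrite normrM -(@ler_pM2l _ 2) //.
  have := sqr_ge0 (`|u i 0| - `|u j 0|); have := abs_le i; have := abs_le j; nra.
apply: le_trans (ler_norm _) _.
by rewrite mulrAC mulrC normrM; apply: ler_wpM2l.
Qed.

Lemma posdefmx_sym n (S : 'M[R]_n) : posdefmx S -> S^T = S.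
Proof. by case. Qed.

Lemma posdefmx_gt0 n (S : 'M[R]_n) u : posdefmx S -> u != 0 -> 0 < bform S u u.
Proof. by case=> _; apply. Qed.

Lemma posdefmx_ge0 n (S : 'M[R]_n) u : posdefmx S -> 0 <= bform S u u.
Proof.
move=> S_gt0; have [->|u_neq0] := eqVneq u 0; first by rewrite bform0l.
exact/ltW/posdefmx_gt0.
Qed.

Lemma negdefmx_lt0 n (S : 'M[R]_n) u : negdefmx S -> u != 0 -> bform S u u < 0.
Proof. by move=> /posdefmx_gt0 S_gt0 /S_gt0; rewrite bform_oppmx oppr_gt0. Qed.

Lemma posdefmx_unit n (S : 'M[R]_n) : posdefmx S -> S \in unitmx.
Proof.
move=> S_gt0; rewrite -row_free_unit -kermx_eq0; apply/rowV0P => v /sub_kermxP vS.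
have [v0|v_neq0] := eqVneq v^T 0; first by rewrite -[v]trmxK v0 trmx0.
by have := posdefmx_gt0 S_gt0 v_neq0; rewrite /bform trmxK vS mul0mx mxE ltxx.
Qed.

(** Expand the form at the combination of [a] and [b] that is orthogonal
    to [b]. *)
Lemma posdefmx_cauchy_schwarz n (S : 'M[R]_n) a b : posdefmx S ->
  bform S a b ^+ 2 <= bform S a a * bform S b b.
Proof.
move=> S_gt0; have [->|b_neq0] := eqVneq b 0; first by rewrite !bform0r expr0n mulr0.
have bb_gt0 := posdefmx_gt0 S_gt0 b_neq0.
have := posdefmx_ge0 (bform S b b *: a + (- bform S a b) *: b) S_gt0.
rewrite !(bformDl, bformDr, bformZl, bformZr) (bform_tr S b a) posdefmx_sym //.
set t := _ + _.
suff -> : t = bform S b b * (bform S a a * bform S b b - bform S a b ^+ 2).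
  by rewrite pmulr_rge0 // subr_ge0.
by rewrite /t; ring.
Qed.

(** A purely algebraic substitute for minimising over the unit sphere: [|u|^2]
    is the form [S] at [u] and [S^-1 u], so the Cauchy-Schwarz inequality bounds
    [|u|^4] by [S(u, u)] times the form [S^-1] at [u], and the latter is at most a
    multiple of [|u|^2]. *)
Lemma posdefmx_coercive n (S : 'M[R]_n) : posdefmx S ->
  exists2 alpha, 0 < alpha & forall u, alpha * sqnorm u <= bform S u u.
Proof.
move=> S_gt0; have S_unit := posdefmx_unit S_gt0.
pose K := 1 + mxabs_sum (invmx S).
have K_gt0 : 0 < K by rewrite ltr_pwDl ?mxabs_sum_ge0.
exists K^-1 => [|u]; first by rewrite invr_gt0.
have [->|u_neq0] := eqVneq u 0; first by rewrite bform0l sqnorm0 mulr0.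
have u_gt0 : 0 < sqnorm u by rewrite lt_neqAle eq_sym sqnorm_eq0 u_neq0 sqnorm_ge0.
rewrite ler_pdivrMl //.
have := posdefmx_cauchy_schwarz u (invmx S *m u) S_gt0.
rewrite -bform_mulr mulmxV // bform1.
have -> : bform S (invmx S *m u) (invmx S *m u) = bform (invmx S) u u.
  rewrite -bform_mulr mulmxV // bform_tr trmx1.
  by rewrite -[in RHS](mul1mx (invmx S)) bform_mulr.
move=> cs; have Su_ge0 := posdefmx_ge0 u S_gt0.
have := bform_le_abs_sum (invmx S) u => Sinv_le.
rewrite -(ler_pM2r u_gt0) -expr2; apply: le_trans cs _.
rewrite [K * _]mulrC -mulrA; apply: ler_wpM2l Su_ge0 _ _ _.
by apply: le_trans Sinv_le _; rewrite ler_wpM2r ?sqnorm_ge0 // lerDr.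
Qed.

(** A Lyapunov function for the block triangular system
    [xi' = K xi + L x], [x' = A x] yields one for its quotient [x' = A x]:
    minimise over [xi].  At the minimiser the gradient in [xi] vanishes, so that
    the unknown initial state and the dynamics of [xi] drop out.  The minimal
    value is the Schur complement [P]. *)
Lemma schur_lyapunov m n (W : 'M[R]_(m + n)) (K : 'M[R]_m) (L : 'M[R]_(m, n))
    (A : 'M[R]_n) : posdefmx W ->
  (forall u, u != 0 -> bform W u (block_mx K L 0 A *m u) < 0) ->
  exists P : 'M[R]_n, [/\ P^T = P,
    forall x, exists xi, bform P x x = bform W (col_mx xi x) (col_mx xi x),
    forall x, bform P x x <= bform W (col_mx 0 x) (col_mx 0 x) &
    forall x, x != 0 -> bform P x (A *m x) < 0].
Proof.
move=> W_gt0 W_decr.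
pose W11 := ulsubmx W; pose W12 := ursubmx W; pose W22 := drsubmx W.
have [W11_sym W22_sym W_def] :
    [/\ W11^T = W11, W22^T = W22 & W = block_mx W11 W12 W12^T W22].
  have := posdefmx_sym W_gt0; rewrite -{1 2}(submxK W) tr_block_mx.
  by move=> /eq_block_mx[? _ dlE ?]; split; rewrite // -[LHS]submxK -dlE.
have W11_gt0 : posdefmx W11.
  split=> // u u_neq0; have := @posdefmx_gt0 _ _ (col_mx u 0) W_gt0.
  rewrite W_def bform_block !(bform0l, bform0r) !addr0; apply.
  by rewrite col_mx_eq0 negb_and u_neq0.
have W11_unit := posdefmx_unit W11_gt0.
pose G := invmx W11 *m W12; pose P := W22 - W12^T *m G.
pose u (x : 'cV[R]_n) := col_mx (- (G *m x)) x.
have Wu x y1 y2 : bform W (col_mx y1 y2) (u x) = bform P y2 x.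
  rewrite W_def bform_block /P bform_addmx bform_oppmx !bformNr bform_mulr.
  rewrite -[bform W11 _ _]bform_mulr /G mulmxA mulmxV // mul1mx; ring.
have P_sym : P^T = P.
  rewrite /P linearB /= W22_sym /G !trmx_mul trmxK trmx_inv W11_sym.
  by rewrite mulmxA.
exists P; split=> // [x|x|x x_neq0].
- by exists (- (G *m x)); rewrite -[RHS]/(bform W (u x) (u x)) Wu.
- rewrite W_def bform_block !(bform0l, bform0r) !add0r.
  rewrite /P bform_addmx bform_oppmx gerDl oppr_le0.
  have -> : bform (W12^T *m G) x x = bform W11 (G *m x) (G *m x).
    rewrite -bform_congr.
    by congr (bform _ _ _); rewrite /G trmx_mul trmx_inv W11_sym mulmxKV.
  exact: posdefmx_ge0.
- have u_neq0 : u x != 0 by rewrite col_mx_eq0 negb_and x_neq0 orbT.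
  have := W_decr _ u_neq0; rewrite /u mul_block_col -/(u x) mul0mx add0r.
  by rewrite bform_tr posdefmx_sym // Wu bform_tr P_sym.
Qed.

End QuadraticForms.

(** * Dissipation of the multiplier along the interconnection *)

Section Dissipation.
Variable R : realType.

Definition closed_loop n k (A : 'M[R]_n) (B : 'M[R]_(n, k)) (C : 'M[R]_(k, n))
    (D : 'M[R]_k) (c : R) : 'M[R]_n :=
  A + c *: B *m (invmx (1%:M - c *: D) *m C).

Lemma kron2_mx2E m (a b c d : R) (S : 'M[R]_m) :
  kron2 (mx2 a b c d) S = block_mx (a *: S) (b *: S) (c *: S) (d *: S).
Proof.
have castl (e : ((1 + 1) * m = m + m)%N) (i : 'I_m) :
    cast_ord (esym e) (lshift m i) = mxtens_index (lshift 1 (0 : 'I_1), i).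
  exact/val_inj.
have castr (e : ((1 + 1) * m = m + m)%N) (i : 'I_m) :
    cast_ord (esym e) (rshift m i) = mxtens_index (rshift 1 (0 : 'I_1), i).
  by apply/val_inj; rewrite /= addn0 mul1n.
apply/matrixP => i j; rewrite castmxE.
case: (fintype.split_ordP i) => i' ->; case: (fintype.split_ordP j) => j' ->.
- by rewrite !castl tensmxE !block_mxEul !mxE eqxx.
- by rewrite castl castr tensmxE !block_mxEur !mxE eqxx.
- by rewrite castl castr tensmxE !block_mxEdl !mxE eqxx.
- by rewrite !castr tensmxE !block_mxEdr !mxE eqxx.
Qed.

Lemma bform_kron2 m (q s r c : R) (S : 'M[R]_m) y z :
  bform (kron2 (mx2 q s s r) S) (col_mx y (c *: y)) (col_mx z (c *: z)) =
  (q + 2 * s * c + r * c ^+ 2) * bform S y z.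
Proof.
by rewrite kron2_mx2E bform_block !bform_scalemx !(bformZl, bformZr); ring.
Qed.

Lemma outer_factor_mul n k np mp (A : 'M[R]_n) (B : 'M[R]_(n, k))
    (C : 'M[R]_(k, n)) (D : 'M[R]_k) (Ap : 'M[R]_np) (Bp : 'M[R]_(np, k))
    (Cp : 'M[R]_(mp, np)) (Dp : 'M[R]_(mp, k))
    (xi1 xi2 : 'cV[R]_np) (x : 'cV[R]_n) (w : 'cV[R]_k) :
  let p := col_mx (col_mx xi1 xi2) x in
  let z := C *m x + D *m w in
  outer_factor A B C D Ap Bp Cp Dp *m col_mx p w =
  col_mx (col_mx p (col_mx (col_mx (Ap *m xi1 + Bp *m z) (Ap *m xi2 + Bp *m w))
                           (A *m x + B *m w)))
         (col_mx (Cp *m xi1 + Dp *m z) (Cp *m xi2 + Dp *m w)).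
Proof.
move=> p z; rewrite /outer_factor /diag2 /p !(mul_col_mx, mul_row_col, mul_block_col).
rewrite !(mul1mx, mul0mx, addr0, add0r, mulmx0, mulmx1) !add_col_mx !addr0.
by rewrite /z !mulmxDr !mulmxA ?addrA.
Qed.

Variables (n k np mp : nat) (A : 'M[R]_n) (B : 'M[R]_(n, k)) (C : 'M[R]_(k, n)).
Variables (D : 'M[R]_k) (q s r : R).
Variables (Ap : 'M[R]_np) (Bp : 'M[R]_(np, k)) (Cp : 'M[R]_(mp, np)).
Variable Dp : 'M[R]_(mp, k).
Variables (X : 'M[R]_(np + np + n)) (Y Z : 'M[R]_np) (M N : 'M[R]_mp).

Let P0 := mx2 q s s r.
Let E := col_mx (row_mx 1%:M 0) (row_mx Ap Bp) : 'M[R]_(np + np, np + k).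
Let F := row_mx Cp Dp : 'M[R]_(mp, np + k).
Let H := outer_factor A B C D Ap Bp Cp Dp.
Let T := X - block_mx (kron2 P0 Y + 2^-1 *: block_mx 0 Z Z 0) 0 0 0.

Hypotheses (X_sym : X^T = X) (Y_sym : Y^T = Y) (Z_sym : Z^T = Z).
Hypothesis Y_lmi : posdefmx (E^T *m block_mx 0 Y Y 0 *m E + F^T *m M *m F).
Hypothesis Z_lmi :
  E^T *m block_mx 0 Z Z 0 *m E + F^T *m (N^T + N) *m F = 0.
Hypothesis X_lmi : negdefmx
  (H^T *m block_mx (block_mx 0 X X 0) 0
                   0 (kron2 P0 M + block_mx 0 N N^T 0) *m H).

Let bform_swap m (S : 'M[R]_m) a b : S^T = S ->
  bform (block_mx 0 S S 0) (col_mx a b) (col_mx a b) = 2 * bform S a b.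
Proof.
by move=> S_sym; rewrite bform_block !bform_zero (bform_tr S b) S_sym; ring.
Qed.

Let EM (xi : 'cV[R]_np) (z : 'cV[R]_k) :
  E *m col_mx xi z = col_mx xi (Ap *m xi + Bp *m z).
Proof. by rewrite /E mul_col_mx !mul_row_col mul1mx mul0mx addr0. Qed.

Let FM (xi : 'cV[R]_np) (z : 'cV[R]_k) : F *m col_mx xi z = Cp *m xi + Dp *m z.
Proof. by rewrite /F mul_row_col. Qed.

Lemma multiplier_ge0 (xi : 'cV[R]_np) (z : 'cV[R]_k) (y := Cp *m xi + Dp *m z) :
  0 <= 2 * bform Y xi (Ap *m xi + Bp *m z) + bform M y y.
Proof.
have := posdefmx_ge0 (col_mx xi z) Y_lmi.
by rewrite bform_addmx !bform_congr EM FM bform_swap.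
Qed.

Lemma multiplier_eq0 (xi : 'cV[R]_np) (z : 'cV[R]_k) (y := Cp *m xi + Dp *m z) :
  2 * bform Z xi (Ap *m xi + Bp *m z) + bform (N^T + N) y y = 0.
Proof.
rewrite -[RHS](bform_zero (col_mx xi z) (col_mx xi z)) -Z_lmi.
by rewrite [RHS]bform_addmx !bform_congr EM FM bform_swap.
Qed.

(** If [w = c z] and the filter copy driven by [w] is started at [c] times the
    state of the copy driven by [z], then it stays [c] times that state.  Along
    such trajectories the multiplier is [q + 2 s c + r c^2 >= 0] times a supply rate
    for which the filter is dissipative plus [c] times one for which it is
    lossless; the storage functions, with matrices [- Y] and [- Z], are what turns
    the form [X] into [T]. *)
Lemma dissipation c (xi : 'cV[R]_np) (x : 'cV[R]_n) (z : 'cV[R]_k) (w := c *: z) :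
    0 <= q + 2 * s * c + r * c ^+ 2 -> z = C *m x + D *m w ->
    col_mx (col_mx xi x) w != 0 ->
  bform T (col_mx (col_mx xi (c *: xi)) x)
    (col_mx (col_mx (Ap *m xi + Bp *m z) (c *: (Ap *m xi + Bp *m z)))
            (A *m x + B *m w)) < 0.
Proof.
move=> c_ge0 z_def u_neq0.
set p := col_mx _ x; set xi' := Ap *m xi + _; set p' := col_mx _ (A *m x + _).
pose y := Cp *m xi + Dp *m z.
have pw_neq0 : col_mx p w != 0.
  by move: u_neq0; rewrite /p !col_mx_eq0 !negb_and => /orP[/orP[]|] ->; rewrite ?orbT.
have := negdefmx_lt0 X_lmi pw_neq0.
rewrite bform_congr /H outer_factor_mul -z_def -/p -/xi'.
have -> : Ap *m (c *: xi) + Bp *m w = c *: xi'.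
  by rewrite -!scalemxAr -scalerDr.
have -> : Cp *m (c *: xi) + Dp *m w = c *: y.
  by rewrite -!scalemxAr -scalerDr.
rewrite -/p' -/y bform_block bform_swap // !bform_zero bform_addmx bform_kron2.
rewrite [bform (block_mx 0 N _ 0) _ _]bform_block !bform_zero bformZl bformZr.
have -> : bform T p p' = bform X p p' - ((q + 2 * s * c + r * c ^+ 2) * bform Y xi xi'
                                        + c * bform Z xi xi').
  rewrite /T bform_addmx bform_oppmx bform_block !bform_zero bform_addmx.
  rewrite bform_kron2 bform_scalemx bform_block !bform_zero bformZl bformZr.
  by field.
have := multiplier_eq0 xi z; rewrite /= -/y -/xi' bform_addmx.
have := multiplier_ge0 xi z; rewrite /= -/y -/xi'.

move: (bform _ p p') (bform _ xi xi') (bform M y y) (bform Z _ _).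
move: (bform N _ _) (bform N^T _ _).
move=> Ny Nty Xp Yx My Zx Y_ge0 Z_eq0.

have := mulr_ge0 c_ge0 Y_ge0.
have : c * (2 * Zx + (Nty + Ny)) = 0 by rewrite Z_eq0 mulr0.
lra.
Qed.

(** A nonzero [z] with [z = D c z] would be a signal [w = c z != 0] that the
    interconnection admits at the zero state, where the form [T] has zero
    derivative and so cannot be strictly decreasing. *)
Lemma well_posed c : 0 <= q + 2 * s * c + r * c ^+ 2 -> 1%:M - c *: D \in unitmx.
Proof.
move=> c_ge0; rewrite -unitmx_tr -row_free_unit -kermx_eq0; apply/rowV0P => v.
move=> /sub_kermxP vD; apply/eqP; rewrite -trmx_eq0; apply/negP => z_neq0.
pose z := v^T; have z_def : z = D *m (c *: z).
  apply/eqP; rewrite -scalemxAr scalemxAl -subr_eq0 -{1}[z]mul1mx -mulmxBl.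
  by rewrite -[_ *m z]trmxK trmx_mul trmxK vD trmx0.
have w_neq0 : c *: z != 0.
  by apply/negP => /eqP w0; move: z_neq0; rewrite -/z z_def w0 mulmx0 eqxx.
have z_def0 : z = C *m 0 + D *m (c *: z) by rewrite mulmx0 add0r.
have u_neq0 : col_mx (col_mx (0 : 'cV[R]_np) (0 : 'cV[R]_n)) (c *: z) != 0.
  by rewrite col_mx_eq0 negb_and w_neq0 orbT.
by have := dissipation c_ge0 z_def0 u_neq0; rewrite scaler0 !col_mx0 bform0l ltxx.
Qed.

(** The filter state is eliminated from the restriction of [T] to the states
    [(xi, c xi, x)].  There [T] is at least a multiple of [|x|^2], by coercivity,
    and the minimum over [xi] is at most the value at [xi = 0], that is at
    [(0, 0, x)]: both bounds are independent of [c]. *)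
Lemma uniform_lyapunov : posdefmx T ->
  exists alpha beta, [/\ 0 < alpha, 0 < beta &
    forall c, 0 <= q + 2 * s * c + r * c ^+ 2 ->
    exists P, [/\ P^T = P,
      forall x, alpha * sqnorm x <= bform P x x,
      forall x, bform P x x <= beta * sqnorm x &
      forall x, x != 0 -> bform P x (closed_loop A B C D c *m x) < 0]].
Proof.
move=> T_gt0; have [alpha alpha_gt0 T_ge] := posdefmx_coercive T_gt0.
exists alpha, (1 + mxabs_sum T); split=> // [|c c_ge0].
  by rewrite ltr_pwDl ?mxabs_sum_ge0.
pose J : 'M[R]_(np + np + n, np + n) := block_mx (col_mx 1%:M c%:M) 0 0 1%:M.
have JM xi (x : 'cV[R]_n) : J *m col_mx xi x = col_mx (col_mx xi (c *: xi)) x.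
  rewrite /J mul_block_col mul_col_mx !mul1mx mul_scalar_mx !mul0mx add0r.
  by rewrite addr0.
pose G := invmx (1%:M - c *: D) *m C.
have G_def (x : 'cV[R]_n) : G *m x = C *m x + D *m (c *: (G *m x)).
  apply/eqP; rewrite -subr_eq -scalemxAr scalemxAl -{1}[G *m x]mul1mx -mulmxBl.
  by rewrite mulmxA /G mulKVmx ?well_posed.
have J_ge xi (x : 'cV[R]_n) :
    alpha * sqnorm x <= bform T (J *m col_mx xi x) (J *m col_mx xi x).
  apply: le_trans (T_ge _); rewrite ler_pM2l // JM !sqnorm_col_mx.
  by rewrite lerDr addr_ge0 ?sqnorm_ge0.
have [||P [P_sym P_val P_le P_lt]] :=
    @schur_lyapunov R np n (J^T *m T *m J) Ap (Bp *m G) (closed_loop A B C D c).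
- split=> [|u u_neq0]; first by rewrite !trmx_mul trmxK posdefmx_sym // mulmxA.
  rewrite -/(bform _ _ _) bform_congr posdefmx_gt0 //.
  apply: contraNneq u_neq0; rewrite -[u]vsubmxK JM.
  by move=> /eqP; rewrite !col_mx_eq0 => /andP[/andP[-> _] ->].
- move=> u; rewrite -[u]vsubmxK; set xi := usubmx u; set x := dsubmx u => u_neq0.
  rewrite mul_block_col mul0mx add0r bform_congr !JM.
  have -> : closed_loop A B C D c *m x = A *m x + B *m (c *: (G *m x)).
    by rewrite mulmxDl -scalemxAr -!scalemxAl !mulmxA.
  by rewrite -(mulmxA Bp); apply: dissipation; rewrite // col_mx_eq0 negb_and u_neq0.
exists P; split=> // x.
  by have [xi ->] := P_val x; rewrite bform_congr.
apply: le_trans (P_le x) _; rewrite bform_congr.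
apply: le_trans (bform_le_abs_sum _ _) _.
rewrite JM !sqnorm_col_mx scaler0 !sqnorm0 !add0r.
by rewrite ler_wpM2r ?sqnorm_ge0 // lerDr.
Qed.

End Dissipation.

(** * Stable transfer functions that are real on the imaginary axis *)

Section RationalFunctions.
Variable R : realType.
Local Notation cpoly := (map_poly (real_complex R)).

Lemma rf_coprime (f : ratfun R) : coprimep (rf_num f) (rf_den f).
Proof.
rewrite /rf_num /rf_den; case: (repr f) => -[p q] /= q_neq0.
by rewrite coprimep_div_gcd // q_neq0 orbT.
Qed.

Lemma pi_ratioM (x : {ratio {poly R}}) :
  (\pi_({fraction {poly R}})%qT x : ratfun R) * tofrac (frac x).2 = tofrac (frac x).1.
Proof.
change (FracField.mul (\pi_({fraction {poly R}})%qT x) (FracField.tofrac (frac x).2)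
        = FracField.tofrac (frac x).1).
rewrite !piE; apply/eqmodP; rewrite /= FracField.equivfE /FracField.mulf.
rewrite !numden_Ratio ?mulf_neq0 ?oner_neq0 ?denom_ratioP //.
by rewrite !mulr1 mulrC.
Qed.

Lemma rf_numden (f : ratfun R) : f = tofrac (rf_num f) / tofrac (rf_den f).
Proof.
have := pi_ratioM (repr f); rewrite reprK /rf_num /rf_den.
case: (repr f) => -[p q] /= q_neq0 fq.
have g_neq0 : gcdp p q != 0 by rewrite gcdp_eq0 negb_and q_neq0 orbT.
have q'_neq0 : q %/ gcdp p q != 0 by rewrite dvdp_div_eq0 ?dvdp_gcdr.
apply: (canRL (mulfK _)); first by rewrite tofrac_eq0.
have gF_neq0 : tofrac (gcdp p q) != 0 by rewrite tofrac_eq0.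
apply: (mulIf gF_neq0); rewrite -mulrA -!tofracM.
by rewrite (divpK (dvdp_gcdr p q)) (divpK (dvdp_gcdl p q)).
Qed.

(** On the imaginary axis conjugation is [s -> - s], so realness of [f = n / d]
    there is the polynomial identity [n(s) d(-s) = n(-s) d(s)].  A root [s0] of [d]
    lies in the open left half-plane and is not a root of [n], so that [- s0] would
    be a root of [d] in the right half-plane.  Thus [f] is a polynomial, and it
    is bounded at infinity. *)
Lemma real_on_axis_const (f : ratfun R) :
    ~ rf_pole_infty f -> (forall s : R[i], 0 <= complex.Re s -> ~ rf_pole f s) ->
    (forall w : R, Num.conj (rf_eval f (Complex 0 w)) = rf_eval f (Complex 0 w)) ->
  exists c : R, f = tofrac c%:P /\ forall s, rf_eval f s = real_complex R c.
Proof.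
move=> proper no_pole real_f; set num := rf_num f; set den := rf_den f.
have [size_num] : (size num <= size den)%N by rewrite leqNgt; apply/negP.
pose Q := cpoly num * (cpoly den \Po (- 'X)) - (cpoly num \Po (- 'X)) * cpoly den.
have conj_cpoly p (s : R[i]) : Num.conj (cpoly p).[s] = (cpoly p).[Num.conj s].
  rewrite -horner_map -map_poly_comp; congr _.[_]; apply: eq_map_poly => x /=.
  exact: conjc_real.
have Q_root w : root Q (Complex 0 w).
  have den_neq0 : (cpoly den).[Complex 0 w] != 0 by apply/negP; apply: no_pole.
  have := real_f w; rewrite /rf_eval -/num -/den fmorph_div /= !conj_cpoly.
  have -> : Num.conj (Complex 0 w) = - Complex 0 w :> R[i].
    by rewrite /=; congr Complex; rewrite oppr0.
  have den_neq0' : (cpoly den).[- Complex 0 w] != 0.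
    apply/negP; apply: no_pole.
    by rewrite /= oppr0.
  move/eqP; rewrite eqr_div // => /eqP nd.
  by rewrite /root /Q !(hornerE, horner_comp) nd subrr.
have Q_eq0 : Q = 0.
  apply: (@roots_geq_poly_eq0 _ _ [seq Complex 0 m%:R | m <- iota 0 (size Q)]).
  - by apply/allP => _ /mapP[m _ ->].
  - rewrite map_inj_uniq ?iota_uniq // => a b [] /eqP.
    by rewrite eqr_nat => /eqP.
  - by rewrite size_map size_iota.
have size_den : size den = 1.
  apply/eqP; rewrite -(size_map_poly (real_complex R)); apply/negPn/negP.
  move=> /closed_rootP[s0 den_s0].
  have s0_lt0 : complex.Re s0 < 0.
    by rewrite ltNge; apply/negP => /no_pole; apply.
  have num_s0 : (cpoly num).[s0] != 0.
    apply: coprimep_root den_s0; rewrite coprimep_map coprimep_sym.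
    exact: rf_coprime.
  have : Q.[s0] = 0 by rewrite Q_eq0 horner0.
  rewrite /Q !(hornerE, horner_comp) (eqP den_s0) mulr0 subr0 => /eqP.
  rewrite mulf_eq0 (negPf num_s0) /= => den_Ns0.
  have := no_pole (- s0); apply=> //.
  by rewrite raddfN oppr_ge0 ltW.
have [d d_neq0 den_d] := size_poly1P _ (introT eqP size_den).
move: size_num; rewrite size_den => /size1_polyC; set n0 := num`_0 => num_n.
exists (n0 / d); split=> [|s].
  apply: etrans (rf_numden f) _; rewrite -/num -/den num_n den_d.
  apply: (canLR (mulfK _)); first by rewrite tofrac_eq0 polyC_eq0.
  by rewrite -tofracM -polyCM divfK.
by rewrite /rf_eval -/num -/den num_n den_d !map_polyC !hornerC fmorph_div.
Qed.

End RationalFunctions.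

(** * Realisations of constant transfer matrices *)

Section Realisation.
Variable R : realType.

Lemma size_det_leq m (S : 'M[{poly R}]_m) :
  (forall i j, size (S i j) <= 2)%N -> (size (\det S) <= m.+1)%N.
Proof.
move=> S_le2; apply: leq_trans (size_sum _ _ _) _; apply/bigmax_leqP => g _.
rewrite -signr_odd mulr_sign; case: ifP => _; rewrite ?size_polyN.
all: apply: leq_trans (size_poly_prod_leq _ _) _.
all: rewrite leq_subLR; apply: leq_trans (_ : (\sum_(i < m) 2).+1 <= _)%N.
all: rewrite ?ltnS ?leq_sum // sum_nat_const card_ord.
all: by rewrite muln2 -addnn addnS.
Qed.

Lemma size_adj_char_poly_mx n (A : 'M[R]_n) i j :
  (size (\adj (char_poly_mx A) i j) <= n)%N.
Proof.
case: n A i j => [|n] A i j; first by case: i.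
rewrite mxE /cofactor -signr_odd mulr_sign; case: ifP => _; rewrite ?size_polyN.
all: apply: size_det_leq => i' j'; rewrite !mxE.
all: apply: leq_trans (size_polyD _ _) _; rewrite size_polyN geq_max.
all: apply/andP; split; last exact: leq_trans (size_polyC_leq1 _) _.
all: by case: (_ == _); rewrite ?size_polyX ?size_poly0.
Qed.

Definition polymx m n (S : 'M[R]_(m, n)) : 'M[{poly R}]_(m, n) := map_mx polyC S.

Lemma polymxM m n p (S : 'M[R]_(m, n)) (S' : 'M[R]_(n, p)) :
  polymx (S *m S') = polymx S *m polymx S'.
Proof. exact: map_mxM. Qed.

Lemma size_sandwich l k m n (C : 'M[R]_(l, m)) (S : 'M[{poly R}]_m)
    (B : 'M[R]_(m, k)) : (forall i j, size (S i j) <= n)%N ->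
  forall i j, (size ((polymx C *m S *m polymx B) i j) <= n)%N.
Proof.
move=> S_le i j; rewrite mxE; apply: leq_trans (size_sum _ _ _) _.
apply/bigmax_leqP => j' _; rewrite !mxE mulrC mul_polyC.
apply: leq_trans (size_scale_leq _ _) _.
apply: leq_trans (size_sum _ _ _) _; apply/bigmax_leqP => i' _.
by rewrite !mxE mul_polyC; apply: leq_trans (size_scale_leq _ _) _.
Qed.

(** The entries of the adjugate of [X - A] have degree below [n], so they cannot
    match a nonzero constant multiple of the characteristic polynomial. *)
Lemma char_poly_scale_small n (A : 'M[R]_n) l k (S : 'M[R]_(l, k))
    (T : 'M[{poly R}]_(l, k)) :
    (forall i j, size (T i j) <= n)%N -> char_poly A *: polymx S = T ->
  S = 0.
Proof.
move=> T_le ST; apply/matrixP => i j; rewrite mxE; apply/eqP/negPn/negP => S_neq0.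
have := T_le i j; rewrite -ST !mxE mulrC mul_polyC size_scale // size_char_poly.
by rewrite ltnn.
Qed.

(** With [chi] the characteristic polynomial of [A], the identity
    [A adj(X - A) = X adj(X - A) - chi] turns the vanishing of
    [C A^j adj(X - A) B] into [C A^(j+1) adj(X - A) B = - chi C A^j B], and a
    comparison of degrees yields both [C A^j B = 0] and the next step. *)
Lemma markov_eq0 n l k (A : 'M[R]_n) (B : 'M[R]_(n, k)) (C : 'M[R]_(l, n)) :
    polymx C *m \adj (char_poly_mx A) *m polymx B = 0 ->
  forall j, C *m A ^+ j *m B = 0.
Proof.
move=> CB0 j; set S := \adj _ in CB0.
have AS : polymx A *m S = 'X *: S - (char_poly A)%:M.
  rewrite /char_poly -mul_mx_adj -/S /char_poly_mx mulmxBl mul_scalar_mx.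
  by rewrite opprB addrC subrK.
have S_le i i' : (size (S i i') <= n)%N by exact: size_adj_char_poly_mx.
have step i : polymx (C *m A ^+ i) *m S *m polymx B = 0 ->
    C *m A ^+ i *m B = 0 /\ polymx (C *m A ^+ i.+1) *m S *m polymx B = 0.
  move=> Ci0.
  have Si : polymx (C *m A ^+ i.+1) *m S *m polymx B =
      - (char_poly A *: polymx (C *m A ^+ i *m B)).
    rewrite exprSr mulmxA polymxM -(mulmxA _ (polymx A)) AS mulmxBr mulmxBl.
    rewrite -scalemxAr -scalemxAl Ci0 scaler0 sub0r mul_mx_scalar.
    by rewrite -scalemxAl -polymxM.
  have CB : C *m A ^+ i *m B = 0.
    apply: (@char_poly_scale_small n A _ _ _
      (- (polymx (C *m A ^+ i.+1) *m S *m polymx B))).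
      by move=> a b; rewrite mxE size_polyN; apply: size_sandwich.
    by rewrite Si opprK.
  by split=> //; rewrite Si CB /polymx map_mx0 scaler0 oppr0.
have Cj : polymx (C *m A ^+ j) *m S *m polymx B = 0.
  elim: j => [|j /step[]] //; by rewrite expr0 mulmx1.
by case: (step _ Cj).
Qed.

Lemma tofrac_mx_inj m n :
  injective (map_mx (@tofrac _) : 'M[{poly R}]_(m, n) -> 'M[ratfun R]_(m, n)).
Proof.
move=> S T /matrixP ST; apply/matrixP => i j.
by have /eqP := ST i j; rewrite !mxE tofrac_eq => /eqP.
Qed.

Lemma transfer_const l k (G : lti R l k) (S : 'M[R]_(l, k)) :
  transfer G = ratmx S ->
  lti_D G = S /\ forall j, lti_C G *m lti_A G ^+ j *m lti_B G = 0.
Proof.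
case: G => n A B C D; rewrite /transfer /= => transfer_S.
have ratmxE p q (M : 'M[R]_(p, q)) : ratmx M = map_mx (@tofrac _) (polymx M).
  by apply/matrixP => i j; rewrite !mxE.
have resE : (tofrac 'X : ratfun R)%:M - ratmx A = map_mx (@tofrac _) (char_poly_mx A).
  by rewrite ratmxE /char_poly_mx map_mxB map_scalar_mx.
have chi_neq0 : (tofrac (char_poly A) : ratfun R) != 0.
  by rewrite tofrac_eq0 monic_neq0 // char_poly_monic.
have invE : invmx ((tofrac 'X : ratfun R)%:M - ratmx A) =
    (tofrac (char_poly A))^-1 *: map_mx (@tofrac _) (\adj (char_poly_mx A)).
  rewrite resE /invmx unitmxE det_map_mx unitfE chi_neq0.
  by rewrite map_mx_adj.
have CSB : polymx C *m \adj (char_poly_mx A) *m polymx B =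
    char_poly A *: polymx (S - D).
  apply: tofrac_mx_inj.
  move/(congr1 (fun M => tofrac (char_poly A) *: (M - ratmx D))): transfer_S.
  rewrite addrK invE -scalemxAr -scalemxAl scalerA divff // scale1r.
  rewrite !ratmxE -!map_mxM => ->.
  by rewrite map_mxZ /polymx !map_mxB.
have SD0 : S - D = 0.
  apply: (@char_poly_scale_small n A _ _ _ _ _ (esym CSB)).
  exact/size_sandwich/size_adj_char_poly_mx.
split; first by apply/esym/eqP; rewrite -subr_eq0 SD0.
by apply: markov_eq0; rewrite CSB SD0 /polymx map_mx0 scaler0.
Qed.

End Realisation.

(** * Constant uncertainties act as gains *)

Section MatrixExponential.
Variable R : realType.

Lemma mxpow_coord_le n (S : 'M[R]_n) m i j :
  `|(S ^+ m) i j| <= mxabs_sum S ^+ m.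
Proof.
elim: m i j => [|m IHm] i j.
  by rewrite !expr0 mxE; case: (_ == _); rewrite ?normr1 ?normr0.
rewrite !exprS mxE; apply: le_trans (ler_norm_sum _ _ _) _.
apply: (@le_trans _ _ ((\sum_l `|S i l|) * mxabs_sum S ^+ m)).
  rewrite mulr_suml; apply: ler_sum => l _.
  by rewrite normrM; apply: ler_wpM2l.
apply: ler_wpM2r; first by rewrite exprn_ge0 ?mxabs_sum_ge0.
rewrite /mxabs_sum [leRHS](bigD1 i) //= lerDl.
by apply: sumr_ge0 => i' _; apply: sumr_ge0.
Qed.

Lemma is_cvg_mxexp n (S : 'M[R]_n) i j :
  cvgn (series (fun m : nat => (m`!%:R)^-1 * (S ^+ m) i j)).
Proof.
apply: normed_cvg; apply: (series_le_cvg _ _ _ (is_cvg_series_exp_coeff (mxabs_sum S))).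
- by move=> m; apply: normr_ge0.
- by move=> m; rewrite /exp_coeff /= divr_ge0 ?exprn_ge0 ?mxabs_sum_ge0.
- move=> m; rewrite /exp_coeff /= normrM ger0_norm ?invr_ge0 // mulrC.
  by apply: ler_wpM2r; rewrite ?invr_ge0 ?mxpow_coord_le.
Qed.

Lemma mxexp_sandwich_eq0 n l k (C : 'M[R]_(l, n)) (S : 'M[R]_n) (B : 'M[R]_(n, k)) :
  (forall m, C *m S ^+ m *m B = 0) -> C *m mxexp S *m B = 0.
Proof.
move=> CSB0; apply/matrixP => a b; rewrite [RHS]mxE.
pose e i j := series (fun m : nat => (m`!%:R)^-1 * (S ^+ m) i j).
have eE m i j : e i j m = (\sum_(0 <= m' < m) (m'`!%:R)^-1 *: S ^+ m') i j.
  by rewrite /e /series /= summxE; apply: eq_bigr => m' _; rewrite mxE.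
have -> : (C *m mxexp S *m B) a b = \sum_j (\sum_i C a i * limn (e i j)) * B j b.
  rewrite mxE; apply: eq_bigr => j _; rewrite mxE; congr (_ * _).
  by apply: eq_bigr => i _; rewrite mxE.
have lim_e : \sum_j (\sum_i C a i * e i j m) * B j b @[m --> \oo] -->
    \sum_j (\sum_i C a i * limn (e i j)) * B j b.
  apply: cvg_big; first exact: add_continuous.
  move=> j _; apply: cvgMr_tmp; apply: cvg_big; first exact: add_continuous.
  by move=> i _; apply: cvgMl_tmp; apply: is_cvg_mxexp.
have e0 : (fun m => \sum_j (\sum_i C a i * e i j m) * B j b) = cst 0.
  apply/funext => m /=.
  transitivity ((C *m (\sum_(0 <= m' < m) (m'`!%:R)^-1 *: S ^+ m') *m B) a b).
    rewrite mxE; apply: eq_bigr => j _; rewrite mxE; congr (_ * _).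
    by apply: eq_bigr => i _; rewrite eE.
  rewrite mulmx_sumr mulmx_suml big1 ?mxE // => m' _.
  by rewrite -scalemxAr -scalemxAl CSB0 scaler0.
rewrite e0 in lim_e; apply: (cvg_unique _ lim_e (cvg_cst _)).
exact: Rhausdorff.
Qed.

Lemma expr_scalemx n (c : R) (S : 'M[R]_n) m : (c *: S) ^+ m = c ^+ m *: S ^+ m.
Proof.
elim: m => [|m IHm]; first by rewrite !expr0 scale1r.
rewrite !exprS IHm [LHS](_ : _ = (c *: S) *m (c ^+ m *: S ^+ m)) //.
by rewrite -scalemxAl -scalemxAr scalerA.
Qed.

Lemma lti_map_const l k (G : lti R l k) (S : 'M[R]_(l, k)) z t :
  transfer G = ratmx S -> lti_map G z t = S *m z t.
Proof.
move=> /transfer_const[<- CAB0]; rewrite /lti_map.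
rewrite (_ : vint _ _ _ = 0) ?add0r //; apply/matrixP => i j; rewrite !mxE.
rewrite (_ : (fun s => _) = cst 0) ?Rintegral_cst ?mul0r //.
apply/funext => s /=; rewrite mxexp_sandwich_eq0 ?mul0mx ?mxE // => m.
by rewrite expr_scalemx -scalemxAr -scalemxAl CAB0 scaler0.
Qed.

End MatrixExponential.

(** * Lyapunov functions along Caratheodory solutions *)

Section Trajectories.
Variable R : realType.

Lemma mulmx_coord_continuous m n (K : 'M[R]_(m, n)) i :
  continuous (fun M : 'cV[R]_n => (K *m M) i 0).
Proof.
have -> : (fun M : 'cV[R]_n => (K *m M) i 0) = fun M => \sum_j K i j * M j 0.
  by apply/funext => M; rewrite mxE.
move=> M; apply: (@cvg_big _ _ _ _ _ add_continuous _ (nbhs M)).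
by move=> j _; apply: cvgMl_tmp; apply: coord_continuous.
Qed.

Lemma bform_continuous n (P : 'M[R]_n) : continuous (fun M : 'cV[R]_n => bform P M M).
Proof.
have -> : (fun M : 'cV[R]_n => bform P M M) = fun M => \sum_i M i 0 * (P *m M) i 0.
  by apply/funext => M; rewrite bformE.
move=> M; apply: (@cvg_big _ _ _ _ _ add_continuous _ (nbhs M)).
move=> i _; apply: cvgM; first exact: coord_continuous.
exact: mulmx_coord_continuous.
Qed.

(** The right-hand side agrees almost everywhere with a continuous
    function, so the solution is classical for positive times. *)
Lemma caratheodory_derive n (K : 'M[R]_n) (x g : R -> 'cV[R]_n) :
    {within `[0, +oo[, continuous x} ->
    (forall i, measurable_fun (`[0, +oo[ : set R) (fun t => g t i 0)) ->
    (forall t, 0 <= t -> x t = x 0 + vint 0 t g) ->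
    {ae (@lebesgue_measure R), forall t : R, 0 <= t -> g t = K *m x t} ->
  forall (t : R) i, 0 < t -> is_derive t 1 (fun s => x s i 0) ((K *m x t) i 0).
Proof.
move=> x_cont g_meas x_int g_ae t i t_gt0.
pose phi s := (K *m x s) i 0.
have phi_cont : {within `[0, +oo[, continuous phi}.
  apply: (@within_continuous_comp _ _ _ _ x (fun M : 'cV[R]_n => (K *m M) i 0)) => //.
  by move=> M _; apply: mulmx_coord_continuous.
have sub_itv u : `[0, u] `<=` (`[0, +oo[ : set R).
  by move=> s /=; rewrite !in_itv /= andbT => /andP[].
have xE u : 0 <= u -> x u i 0 = x 0 i 0 + \int[lebesgue_measure]_(s in `[0, u]) phi s.
  move=> u_ge0; rewrite {1}x_int // !mxE; congr (_ + _).
  rewrite /Rintegral; congr fine; apply: ae_eq_integral => //.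
  - apply/measurable_EFinP; apply: measurable_funS (g_meas i) => //.
  - apply/measurable_EFinP.
    apply: measurable_funS (_ : measurable_fun (`[0, +oo[ : set R) phi) => //.
    exact: subspace_continuous_measurable_fun.
  - apply: (@filterS _ _ (ae_filter_ringOfSetsType lebesgue_measure)) g_ae => s gs /=.
    rewrite in_itv /= => /andP[s_ge0 _].
    by rewrite gs.
have phi_int : lebesgue_measure.-integrable `[0, t + 1] (EFin \o phi).
  apply: continuous_compact_integrable; first exact: segment_compact.
  exact: continuous_subspaceW phi_cont.
have t_lt : t < t + 1 by rewrite ltrDl.
have phi_cont_t : {for t, continuous phi}.
  apply: (@within_continuous_continuous _ _ _ 0 (t + 1)).
  - by rewrite (lt_trans t_gt0).
  - exact: continuous_subspaceW phi_cont.
  - by rewrite in_itv /= t_gt0.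
have [F_der F_val] :=
  @continuous_FTC1 _ phi (BLeft 0) t (t + 1) t_lt phi_int t_gt0 phi_cont_t.
have F_is : is_derive t 1
    (fun u => x 0 i 0 + \int[lebesgue_measure]_(s in `[0, u]) phi s) (phi t).
  rewrite -[phi t]add0r; apply: is_deriveD.
  by rewrite -F_val derive1E; apply: DeriveDef.
apply: near_eq_is_derive F_is.
by apply: filterS (lt_nbhsr t_gt0) => u /ltW u_ge0; rewrite [RHS]xE.
Qed.

Lemma is_derive_mulmx_coord m n (K : 'M[R]_(m, n)) (x : R -> 'cV[R]_n) (t : R)
    (dx : 'cV[R]_n) :
    (forall i, is_derive t 1 (fun s => x s i 0) (dx i 0)) ->
  forall i, is_derive t 1 (fun s => (K *m x s) i 0) ((K *m dx) i 0).
Proof.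
move=> x_der i.
rewrite (_ : (fun s => _) = \sum_j (K i j \*: (fun s => x s j 0))); last first.
  by apply/funext => s; rewrite mxE fct_sumE.
rewrite mxE; apply: is_derive_sum => j; exact: is_deriveZ.
Qed.

Lemma is_derive_bform n (P : 'M[R]_n) (x : R -> 'cV[R]_n) (t : R) (dx : 'cV[R]_n) :
    P^T = P -> (forall i, is_derive t 1 (fun s => x s i 0) (dx i 0)) ->
  is_derive t 1 (fun s => bform P (x s) (x s)) (2 * bform P (x t) dx).
Proof.
move=> P_sym x_der.
rewrite (_ : (fun s => _) =
    \sum_i ((fun s => x s i 0) * (fun s => (P *m x s) i 0))); last first.
  by apply/funext => s; rewrite bformE fct_sumE.
rewrite mulr2n mulrDl mul1r {2}bform_tr P_sym !bformE -big_split /=.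
apply: is_derive_sum => i; apply: is_derive_eq.
  by apply: is_deriveM; last exact: is_derive_mulmx_coord.
by rewrite /GRing.scale /= [(P *m x t) i 0 * _]mulrC.
Qed.

(** The derivative of [x^T P x] is a negative definite form, hence by
    coercivity at most [- gamma x^T P x]; so [e^(gamma t) x^T P x] is nonincreasing. *)
Lemma lyapunov_decay n (P K : 'M[R]_n) (x : R -> 'cV[R]_n) beta :
    P^T = P -> 0 < beta -> (forall u, bform P u u <= beta * sqnorm u) ->
    (forall u, u != 0 -> bform P u (K *m u) < 0) ->
    {within `[0, +oo[, continuous x} ->
    (forall (t : R) i, 0 < t -> is_derive t 1 (fun s => x s i 0) ((K *m x t) i 0)) ->
  exists2 gamma, 0 < gamma & forall t, 0 <= t ->
    expR (gamma * t) * bform P (x t) (x t) <= bform P (x 0) (x 0).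
Proof.
move=> P_sym beta_gt0 P_le P_lt x_cont x_der.
have [eps eps_gt0 S_ge] : exists2 eps, 0 < eps &
    forall u, eps * sqnorm u <= - (2 * bform P u (K *m u)).
  pose S := - (P *m K + (P *m K)^T).
  have SE u : bform S u u = - (2 * bform P u (K *m u)).
    rewrite bform_oppmx bform_addmx -(bform_tr (P *m K)) bform_mulr.
    by ring.
  have S_gt0 : posdefmx S.
    split=> [|u u_neq0]; first by rewrite linearN linearD /= trmxK addrC.
    by rewrite -/(bform S u u) SE oppr_gt0 pmulr_rlt0 // P_lt.
  have [eps eps_gt0 S_ge] := posdefmx_coercive S_gt0.
  by exists eps => // u; rewrite -SE.
(* [beta] turns the decrease [eps |x|^2] into one proportional to the form. *)
pose gamma := eps / beta; have gamma_gt0 : 0 < gamma by rewrite divr_gt0.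
exists gamma => // t t_ge0.
pose h s := expR (gamma * s) * bform P (x s) (x s).
have exp_der (s : R) :
    is_derive s 1 (fun s => expR (gamma * s)) (expR (gamma * s) * gamma).
  apply: (@is_derive1_comp _ expR (fun s => gamma * s) s).
  rewrite -[X in is_derive _ _ _ X]mulr1; exact: is_deriveZ.
have h_der (s : R) : 0 < s -> is_derive s 1 h
    (expR (gamma * s) * (2 * bform P (x s) (K *m x s) + gamma * bform P (x s) (x s))).
  move=> s_gt0; apply: is_derive_eq.
    apply: is_deriveM; apply: is_derive_bform => // i; exact: x_der.
  by rewrite /GRing.scale /=; ring.
have h0 : h 0 = bform P (x 0) (x 0) by rewrite /h mulr0 expR0 mul1r.
rewrite -[leRHS]h0 -/(h t); apply: (@ler0_derive1_nincry _ h 0) => //.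
- move=> s; rewrite in_itv /= andbT => /h_der h_der_s; exact: ex_derive.
- move=> s; rewrite in_itv /= andbT => /h_der h_der_s.
  rewrite derive1E derive_val pmulr_rle0 ?expR_gt0 //.
  have : gamma * bform P (x s) (x s) <= eps * sqnorm (x s).
    by rewrite /gamma mulrAC ler_pdivrMr // -mulrA [_ * beta]mulrC ler_pM2l.
  have := S_ge (x s); lra.
- move=> s; apply: cvgM.
    apply: continuous_subspaceT => s'.
    by apply: differentiable_continuous; apply/derivable1_diffP; exact: ex_derive.
  apply: (@within_continuous_comp _ _ _ _ x (fun M : 'cV[R]_n => bform P M M)) => //.
  by move=> M _; apply: bform_continuous.
Qed.

Lemma lyapunov_stable n (P K : 'M[R]_n) (x : R -> 'cV[R]_n) alpha beta :
    P^T = P -> 0 < alpha -> 0 < beta ->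
    (forall u, alpha * sqnorm u <= bform P u u) ->
    (forall u, bform P u u <= beta * sqnorm u) ->
    (forall u, u != 0 -> bform P u (K *m u) < 0) ->
    {within `[0, +oo[, continuous x} ->
    (forall (t : R) i, 0 < t -> is_derive t 1 (fun s => x s i 0) ((K *m x t) i 0)) ->
  x t @[t --> +oo] --> (0 : 'cV[R]_n) /\
  forall t, 0 <= t -> vnorm (x t) <= Num.sqrt (beta / alpha) * vnorm (x 0).
Proof.
move=> P_sym alpha_gt0 beta_gt0 P_ge P_le P_lt x_cont x_der.
have [gamma gamma_gt0 x_decay] := lyapunov_decay P_sym beta_gt0 P_le P_lt x_cont x_der.
have P_ge0 u : 0 <= bform P u u.
  by apply: le_trans (P_ge u); rewrite mulr_ge0 ?sqnorm_ge0 // ltW.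
split; last first.
  have ba_ge0 : 0 <= beta / alpha by rewrite divr_ge0 // ltW.
  move=> t t_ge0; rewrite /vnorm -/(sqnorm _) -/(sqnorm _) -sqrtrM //.
  apply: ler_wsqrtr.
  rewrite mulrAC ler_pdivlMr // mulrC; apply: le_trans (P_ge _) _.
  apply: le_trans (P_le _); apply: le_trans (x_decay _ t_ge0).
  by rewrite ler_peMl // -expR0 ler_expR mulr_ge0 // ltW.
apply/cvg_ballP => e e_gt0.
have e2_gt0 : 0 < gamma * alpha * e ^+ 2 by rewrite !mulr_gt0 ?exprn_gt0.
near=> t.
(* As [e^(gamma t) > gamma t], this threshold for [t] forces [|x(t)|^2 < e^2]. *)
have t_gt0 : 0 < t by near: t; apply: nbhs_pinfty_gt; rewrite num_real.
have t_gt : bform P (x 0) (x 0) / (gamma * alpha * e ^+ 2) < t.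
  by near: t; apply: nbhs_pinfty_gt; rewrite num_real.
split=> // i j; rewrite ord1 /ball /= mxE sub0r normrN.
rewrite -ltr_sqr ?nnegrE ?normr_ge0 ?(ltW e_gt0) // real_normK ?num_real //.
apply: le_lt_trans (sqr_coord_le _ _) _.
move: t_gt; rewrite ltr_pdivrMr // => t_gt.
have := x_decay _ (ltW t_gt0); have := expR_ge1Dx (gamma * t).
have gt_gt0 : 0 < gamma * t by rewrite mulr_gt0.
set E := expR _ => E_ge Vt_le.
have : gamma * t * (alpha * sqnorm (x t)) <= bform P (x 0) (x 0).
  apply: le_trans Vt_le; apply: ler_pM => //; rewrite ?mulr_ge0 ?sqnorm_ge0 ?ltW //.
  by apply: lt_le_trans E_ge; rewrite ltrDr.
move=> /le_lt_trans /(_ t_gt).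
rewrite (_ : t * _ = gamma * t * (alpha * e ^+ 2)); last by ring.
by rewrite ltr_pM2l // ltr_pM2l.
Unshelve. all: by end_near. Qed.

End Trajectories.

(** * Reduction of the uncertainty to a real parameter *)

Section Uncertainty.
Variable R : realType.

Lemma real_repeatedP k (q s r : R) (U : 'M[R[i]]_k) :
    real_repeated (mx2 q s s r) U ->
  exists2 c : R, 0 <= q + 2 * s * c + r * c ^+ 2 & U = cplxmx c%:M.
Proof.
move=> [v []] ->.
have stackE : ctrmx (stack1 v) = row_mx 1%:M (Num.conj v)%:M.
  rewrite /ctrmx /stack1 tr_col_mx map_row_mx !tr_scalar_mx !map_scalar_mx /=.
  by rewrite rmorph1.
have formE (a b c d : R[i]) : (ctrmx (stack1 v) *m mx2 a b c d *m stack1 v) 0 0 =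
    a + Num.conj v * c + (b + Num.conj v * d) * v.
  rewrite stackE /mx2 /stack1 mul_row_block mul_row_col -!scalar_mxM -!raddfD /=.
  by rewrite -!scalar_mxM -!raddfD /= mxE eqxx mulr1n !mul1r mulr1.
have -> : cplxmx (mx2 q s s r) = mx2 (real_complex R q) (real_complex R s)
    (real_complex R s) (real_complex R r).
  by rewrite /cplxmx /mx2 map_block_mx !map_scalar_mx.
rewrite !formE => v_ge0 v_real.
have {v_real} v_real : Num.conj v = v.
  have : 'i * (v - Num.conj v) = 0 by rewrite -[RHS]v_real; ring.
  by move=> /eqP; rewrite mulf_eq0 (negPf (neq0Ci _)) subr_eq0 => /eqP.
have vE : v = real_complex R (complex.Re v).
  by rewrite RRe_real //; apply/CrealP.
exists (complex.Re v); last by rewrite /cplxmx map_scalar_mx /= -vE.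
rewrite -lecR; apply: le_trans v_ge0 _; rewrite v_real le_eqVlt; apply/orP; left.
by rewrite !(rmorphD, rmorphM, rmorphXn, rmorph_nat) /= -vE; apply/eqP; ring.
Qed.

Lemma uncertainty_gain k (q s r : R) (G : lti R k k) :
    uncertainty (real_repeated (mx2 q s s r)) G ->
  exists2 c : R, 0 <= q + 2 * s * c + r * c ^+ 2 & transfer G = ratmx c%:M.
Proof.
move=> [stable on_axis _].
have entry i j : exists c : R, transfer G i j = tofrac c%:P /\
    forall z, rf_eval (transfer G i j) z = real_complex R c.
  have [proper no_pole] := stable i j; apply: real_on_axis_const => // w.
  have [c _ /matrixP/(_ i j)] := real_repeatedP (on_axis w); rewrite !mxE => ->.
  exact: conjc_real.
have [c c_ge0 /matrixP at0] := real_repeatedP (on_axis 0).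
exists c => //; apply/matrixP => i j; have [d [trE d_eval]] := entry i j.
by rewrite trE; have := at0 i j; rewrite mxE d_eval !mxE => /complexI ->.
Qed.

Lemma trajectory_closed_loop n k (A : 'M[R]_n) (B : 'M[R]_(n, k)) (C : 'M[R]_(k, n))
    (D : 'M[R]_k) (G : lti R k k) c x z w :
    1%:M - c *: D \in unitmx -> transfer G = ratmx c%:M ->
    trajectory A B C D G x z w ->
  forall (t : R) i, 0 < t ->
    is_derive t 1 (fun s => x s i 0) ((closed_loop A B C D c *m x t) i 0).
Proof.
move=> D_unit G_c [[_ [w_meas _]] x_cont x_int z_ae w_ae].
apply: (caratheodory_derive x_cont _ x_int).
  move=> i; rewrite (_ : (fun t => _) =
      (fun t => (A *m x t) i 0 + \sum_j B i j * w t j 0)); last first.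
    by apply/funext => t; rewrite !mxE.
  apply: measurable_funD.
    apply: subspace_continuous_measurable_fun => //.
    apply: (@within_continuous_comp _ _ _ _ x (fun M : 'cV[R]_n => (A *m M) i 0)) => //.
    by move=> M _; apply: mulmx_coord_continuous.
  by apply: measurable_sum => j; apply: measurable_funM.
apply: (@filterS2 _ _ (ae_filter_ringOfSetsType lebesgue_measure)
  _ _ _ _ z_ae w_ae) => t zE wE t_ge0.
have {wE} wE : w t = c *: z t by rewrite wE // (lti_map_const _ _ G_c) mul_scalar_mx.
have zE' : z t = invmx (1%:M - c *: D) *m (C *m x t).
  apply: (canRL (mulKmx D_unit)); apply/eqP.
  by rewrite mulmxBl mul1mx subr_eq -scalemxAl scalemxAr -wE -zE.
by rewrite wE zE' mulmxDl -scalemxAr -!scalemxAl !mulmxA.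
Qed.

End Uncertainty.

Theorem theorem11 (R : realType) (n k np mp : nat)
    (A : 'M[R]_n) (B : 'M[R]_(n, k)) (C : 'M[R]_(k, n)) (D : 'M[R]_k)
    (q s r : R) (r_le0 : r <= 0)
    (Ap : 'M[R]_np) (Bp : 'M[R]_(np, k)) (Cp : 'M[R]_(mp, np))
    (Dp : 'M[R]_(mp, k)) (Ap_hurwitz : hurwitz Ap) :
  let P0 := mx2 q s s r in
  let E := col_mx (row_mx 1%:M 0) (row_mx Ap Bp) : 'M[R]_(np + np, np + k) in
  let F := row_mx Cp Dp : 'M[R]_(mp, np + k) in
  let H := outer_factor A B C D Ap Bp Cp Dp in
  (exists (X : 'M[R]_(np + np + n)) (Y Z : 'M[R]_np) (M N : 'M[R]_mp),
    [/\ [/\ X^T = X, Y^T = Y, Z^T = Z & M^T = M],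
        posdefmx (E^T *m block_mx 0 Y Y 0 *m E + F^T *m M *m F),
        E^T *m block_mx 0 Z Z 0 *m E + F^T *m (N^T + N) *m F = 0,
        negdefmx
          (H^T *m block_mx (block_mx 0 X X 0) 0
                           0 (kron2 P0 M + block_mx 0 N N^T 0) *m H) &
        posdefmx
          (X - block_mx (kron2 P0 Y + 2^-1 *: block_mx 0 Z Z 0) 0 0 0)]) ->
  robustly_stable A B C D (@real_repeated R k P0).
Proof.
move=> P0 E F H [X [Y [Z [M [N [[X_sym Y_sym Z_sym _] Y_lmi Z_lmi X_lmi T_gt0]]]]]].
have D_unit c := @well_posed R n k np mp A B C D q s r Ap Bp Cp Dp X Y Z M N
  X_sym Y_sym Z_sym Y_lmi Z_lmi X_lmi c.
have [alpha [beta [alpha_gt0 beta_gt0 lyap]]] := uniform_lyapunov X_sym Y_sym Z_sym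
  Y_lmi Z_lmi X_lmi T_gt0.
split.
  move=> _ /real_repeatedP[c c_ge0 ->].
  rewrite (_ : _ - _ = cplxmx (1%:M - c *: D)).
    by rewrite det_map_mx fmorph_eq0 -unitfE -unitmxE D_unit.
  by rewrite -map_mxM mul_mx_scalar /cplxmx map_mxB map_scalar_mx /= rmorph1.
exists (Num.sqrt (beta / alpha)); first by rewrite sqrtr_gt0 divr_gt0.
move=> G /uncertainty_gain[c c_ge0 G_c] x z w xzw.
have [P [P_sym P_ge P_le P_lt]] := lyap c c_ge0.
apply: (lyapunov_stable P_sym alpha_gt0 beta_gt0 P_ge P_le P_lt); first by case: xzw.
exact: trajectory_closed_loop (D_unit c c_ge0) G_c xzw.
Qed.
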